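(* Program location reachability for Boolean dual-reference programs run by an unbounded number of threads is undecidable. That is, the following decision problem is undecidable: given a Boolean dual-reference program $\tilde{\mathcal{P}}=(\tilde{\mathcal{R}},\tilde{\mathcal{I}})$ and a program location $\ell$, decide whether there exist a number of threads $n\ge 2$ and an execution of the $n$-thread instantiation $\tilde{\mathcal{P}}^n$ that ends in a state in which some thread is in program location $\ell$.
   Context: A *dual-reference (DR) program* $\tilde{\mathcal{P}}=(\tilde{\mathcal{R}},\tilde{\mathcal{I}})$ has variable set $\tilde V=\tilde L\uplus\tilde L_P$, where $\tilde L$ is a finite set of local variables (of the active thread), including a program counter $\mathtt{pc}$ ranging over a finite set of program locations, and $\tilde L_P=\{l_P : l\in\tilde L\}$ is the set of corresponding passive-thread variables. $\tilde{\mathcal{R}}$ is a transition formula over $\tilde V\cup\tilde V'$ (unprimed = current-state, primed = next-state variables) and $\tilde{\mathcal{I}}$ is an initial formula over $\tilde V$. The program is *Boolean* if all its variables are Boolean (equivalently, up to encoding, range over finite domains). For each thread $i$ let $\tilde L_i=\{l_i : l\in\tilde L\}$. For a formula $f$, $f\{X_1\triangleright X_2\}$ denotes $f$ with each variable of $X_1$ replaced by the variable of $X_2$ with the same base name, and $f\{X_1\triangleright\triangleright X_2\}$ does so for both unprimed and primed variables. For $n\ge2$ the $n$-thread instantiation is $\tilde{\mathcal{P}}^n=(\tilde{\mathcal{R}}^n,\tilde{\mathcal{I}}^n)=(\bigvee_{a=1}^n(\tilde{\mathcal{R}}_a)^n,\ \bigvee_{a=1}^n(\tilde{\mathcal{I}}_a)^n)$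 with $$(\tilde{\mathcal{R}}_a)^n := \bigwedge_{p\neq a}\tilde{\mathcal{R}}\{\tilde L\triangleright\triangleright\tilde L_a\}\{\tilde L_P\triangleright\triangleright\tilde L_p\},\qquad (\tilde{\mathcal{I}}_a)^n := \bigwedge_{p\neq a}\tilde{\mathcal{I}}\{\tilde L\triangleright\tilde L_a\}\{\tilde L_P\triangleright\tilde L_p\},$$ where $p$ ranges over $\{1,\dots,n\}\setminus\{a\}$. An $n$-thread state is a valuation of $\tilde L_1\cup\dots\cup\tilde L_n$; an execution of $\tilde{\mathcal{P}}^n$ is a sequence of $n$-thread states whose first state satisfies $\tilde{\mathcal{I}}^n$ and whose consecutive states are related by $\tilde{\mathcal{R}}^n$. Thread $i$ is in location $\ell$ in a state if $\mathtt{pc}_i=\ell$ there. *)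

(* Defs.v *)
From mathcomp Require Import all_boot.
Set Implicit Arguments.
Unset Strict Implicit.
Unset Printing Implicit Defensive.

(* Kleene's partial recursive functions of arity [n]. *)
Inductive recfun : nat -> Type :=
  | RZero n : recfun n
  | RSucc : recfun 1
  | RProj n (i : 'I_n) : recfun n
  | RComp m n (f : recfun m) (g : 'I_m -> recfun n) : recfun n
  | RPrim n (f : recfun n) (g : recfun n.+2) : recfun n.+1
  | RMu n (f : recfun n.+1) : recfun n.

Fixpoint prim_graph (F : nat -> Prop) (G : nat -> nat -> nat -> Prop)
    (k y : nat) : Prop :=
  if k is k'.+1 then exists2 z, prim_graph F G k' z & G k' z y else F y.

(* [computes f v y]: the partial function [f] is defined at [v], with value
   [y].  In [RPrim] the recursion argument is the first one and the step
   function receives (counter, previous value, parameters).  [RMu] requires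
   [f] to be defined (and nonzero) at every argument below the result. *)
Fixpoint computes n (f : recfun n) : n.-tuple nat -> nat -> Prop :=
  match f in recfun n return n.-tuple nat -> nat -> Prop with
  | RZero _ => fun _ y => y = 0
  | RSucc => fun v y => y = (thead v).+1
  | RProj _ i => fun v y => y = tnth v i
  | RComp m _ f g => fun v y =>
      exists2 w : m.-tuple nat,
        forall i, computes (g i) v (tnth w i) & computes f w y
  | RPrim _ f g => fun v y =>
      prim_graph (computes f [tuple of behead v])
        (fun k z => computes g [tuple of k :: z :: behead v]) (thead v) y
  | RMu _ f => fun v y =>
      computes f [tuple of y :: v] 0 /\
      forall k, k < y -> exists z, computes f [tuple of k :: v] z.+1
  end.

Lemma computes_fun n (f : recfun n) v y z :
  computes f v y -> computes f v z -> y = z.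
Proof.
elim: f v y z => {n} [n||n i|m n f IHf g IHg|n f IHf g IHg|n f IHf] v y z /=.
- by move=> -> ->.
- by move=> -> ->.
- by move=> -> ->.
- move=> [w gw fw] [w' gw' fw']; suff ww' : w = w' by subst w'; apply: IHf fw fw'.
  by apply: eq_from_tnth => i; apply: IHg (gw i) (gw' i).
- elim: (thead v) y z => [|k IHk] y z /=; first exact: IHf.
  move=> [u ru gu] [u' ru' gu']; have uu' := IHk _ _ ru ru'; subst u'.
  exact: IHg gu gu'.
- move=> [fy ly] [fz lz]; case: (ltngtP y z) => // lt_yz.
  + by have [t ft] := lz _ lt_yz; have := IHf _ _ _ fy ft.
  + by have [t ft] := ly _ lt_yz; have := IHf _ _ _ fz ft.
Qed.

(* The decision problem "given [x : X], does [Q x] hold?", whose instances are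
   presented through the Goedel numbering [code].  Nothing is required of the
   algorithm on numbers that encode no instance. *)
Definition recursively_decidable (X : Type) (code : X -> nat) (Q : X -> Prop) :
    Prop :=
  exists f : recfun 1, forall x : X,
    (Q x -> computes f [tuple code x] 1) /\
    (~ Q x -> computes f [tuple code x] 0).

(* The local variables are [m] Boolean variables and a program counter that
   ranges over [k] locations.  A formula speaks about several copies of them,
   named by [T]; for instance [FVar t x] is the copy [t] of variable [x]. *)
Inductive formula (m k : nat) (T : Type) : Type :=
  | FConst of bool
  | FVar of T & 'I_m
  | FAt of T & 'I_k (* pc_t = l *)
  | FSame of T & T  (* pc_t = pc_u *)
  | FNot of formula m k T
  | FAnd of formula m k T & formula m k T
  | FOr of formula m k T & formula m k T.

Arguments FConst {m k T}.
Arguments FVar {m k T}.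
Arguments FAt {m k T}.
Arguments FSame {m k T}.
Arguments FNot {m k T}.
Arguments FAnd {m k T}.
Arguments FOr {m k T}.

Fixpoint rename m k (T U : Type) (r : T -> U) (f : formula m k T) :
    formula m k U :=
  match f with
  | FConst b => FConst b
  | FVar t x => FVar (r t) x
  | FAt t l => FAt (r t) l
  | FSame t u => FSame (r t) (r u)
  | FNot f => FNot (rename r f)
  | FAnd f g => FAnd (rename r f) (rename r g)
  | FOr f g => FOr (rename r f) (rename r g)
  end.

Record lstate (m k : nat) := LState { lvar : {ffun 'I_m -> bool}; pc : 'I_k }.

Fixpoint holds m k (T : Type) (s : T -> lstate m k) (f : formula m k T) : bool :=
  match f with
  | FConst b => b
  | FVar t x => lvar (s t) x
  | FAt t l => pc (s t) == l
  | FSame t u => pc (s t) == pc (s u)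
  | FNot f => ~~ holds s f
  | FAnd f g => holds s f && holds s g
  | FOr f g => holds s f || holds s g
  end.

Variant role := Active | Passive.
Variant stage := Current | Next. (* unprimed, primed *)

Record drprog := DRProg {
  nvars : nat;
  nlocs : nat;
  trans : formula nvars nlocs (role * stage);
  init : formula nvars nlocs role
}.

(* [rename (thread a p)] is the substitution {L |> L_a}{L_P |> L_p}; the two
   replacements may be simultaneous because L_a and L_P are disjoint. *)
Definition thread n (a p : 'I_n) (r : role) : 'I_n :=
  if r is Active then a else p.

Definition trans_at (P : drprog) (n : nat) (a : 'I_n) :
    formula (nvars P) (nlocs P) ('I_n * stage) :=
  \big[FAnd/FConst true]_(p < n | p != a)
    rename (fun t => (thread a p t.1, t.2)) (trans P).

Definition init_at (P : drprog) (n : nat) (a : 'I_n) :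
    formula (nvars P) (nlocs P) 'I_n :=
  \big[FAnd/FConst true]_(p < n | p != a) rename (thread a p) (init P).

Definition transn (P : drprog) (n : nat) :
    formula (nvars P) (nlocs P) ('I_n * stage) :=
  \big[FOr/FConst false]_(a < n) trans_at P a.

Definition initn (P : drprog) (n : nat) : formula (nvars P) (nlocs P) 'I_n :=
  \big[FOr/FConst false]_(a < n) init_at P a.

Definition nstate (P : drprog) (n : nat) : Type :=
  'I_n -> lstate (nvars P) (nlocs P).

Definition step (P : drprog) (n : nat) (s s' : nstate P n) : bool :=
  holds (fun t => if t.2 is Current then s t.1 else s' t.1) (transn P n).

(* The nonempty sequence [s0 :: s] of states is an execution. *)
Definition execution (P : drprog) (n : nat) (s0 : nstate P n)
    (s : seq (nstate P n)) : bool :=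
  holds s0 (initn P n) && path (@step P n) s0 s.

Definition loc_reachable (P : drprog) (l : 'I_(nlocs P)) : Prop :=
  exists n, 2 <= n /\ exists (s0 : nstate P n) (s : seq (nstate P n)),
    execution s0 s /\ exists i : 'I_n, pc (last s0 s i) = l.

(* [CodeSeq.code] is the library's explicit bijection from [seq nat] to [nat],
   with [code [::] = 0] and [code (n :: s) = 2 ^ n * (2 * code s + 1)]. *)
Fixpoint code_formula m k (T : Type) (c : T -> nat) (f : formula m k T) : nat :=
  match f with
  | FConst b => CodeSeq.code [:: 0; b : nat]
  | FVar t x => CodeSeq.code [:: 1; c t; x : nat]
  | FAt t l => CodeSeq.code [:: 2; c t; l : nat]
  | FSame t u => CodeSeq.code [:: 3; c t; c u]
  | FNot f => CodeSeq.code [:: 4; code_formula c f]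
  | FAnd f g => CodeSeq.code [:: 5; code_formula c f; code_formula c g]
  | FOr f g => CodeSeq.code [:: 6; code_formula c f; code_formula c g]
  end.

Definition code_role (r : role) : nat := if r is Active then 0 else 1.

Definition code_copy (t : role * stage) : nat :=
  (code_role t.1).*2 + (if t.2 is Current then 0 else 1).

Definition drinstance : Type := {P : drprog & 'I_(nlocs P)}.

Definition code_instance (x : drinstance) : nat :=
  let: existT P l := x in
  CodeSeq.code [:: nvars P; nlocs P; code_formula code_copy (trans P);
                   code_formula code_role (init P); l : nat].

Lemma code_formula_inj m k (T : Type) (c : T -> nat) :
  injective c -> injective (@code_formula m k T c).
Proof.
move=> c_inj; have K := can_inj CodeSeq.codeK.
elim=> [b|t x|t x|t u|f IHf|f IHf g IHg|f IHf g IHg]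
  [b'|t' x'|t' x'|t' u'|f'|f' g'|f' g'] E; have {E} := K _ _ E => // -[].
- by case: b; case: b'.
- by move=> /c_inj-> /val_inj->.
- by move=> /c_inj-> /val_inj->.
- by move=> /c_inj-> /c_inj->.
- by move=> /IHf->.
- by move=> /IHf-> /IHg->.
- by move=> /IHf-> /IHg->.
Qed.

Lemma code_instance_inj : injective code_instance.
Proof.
have r_inj : injective code_role by move=> [] [].
have c_inj : injective code_copy by move=> [[] []] [[] []].
move=> [[m k R I] l] [[m' k' R' I'] l'] /(can_inj CodeSeq.codeK) /= [em ek].
subst m' k' => /(code_formula_inj c_inj)-> /(code_formula_inj r_inj)->.
by move=> /val_inj->.
Qed.

(* Main.v *)
Require Import Defs.
From mathcomp Require Import all_boot.
From mathcomp Require Import zify.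
Set Implicit Arguments.
Unset Strict Implicit.
Unset Printing Implicit Defensive.

(* Keep the program counters of all threads equal and let each counter of a
   counter machine be the number of threads whose corresponding Boolean
   variable is true.  An increment or decrement flips that variable of the
   active thread, a zero test requires it to be false in the active thread and
   in every passive one, and the number of threads bounds the counters of a
   run; so location reachability for some number of threads is halting.

   Given a decision procedure f, let h(L, B) search for a y with
   f(c(L, B)) = 0, where c(L, B) codes the program that first loads L and B into
   two counters by a chain of L + B locations and then continues with the
   formula coded by B.  If L and B describe a machine for h itself, the program
   coded by c(L, B) reaches its halting location iff h(L, B) halts, iff f
   rejects that program. *)

(** * Counter programs *)

Inductive op := Nop | Inc of nat | Dec of nat | Zero of nat.

Inductive prog := Act of op | Seq of prog & prog | Star of prog.

Definition upd (s : nat -> nat) (c v r : nat) : nat :=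
  if r == c then v else s r.

(* [Dec] and [Zero] block when their guard fails; the control flow of a program
   is nondeterministic and these guards are what resolves it. *)
Definition op_rel (o : op) (s s' : nat -> nat) : Prop :=
  match o with
  | Nop => s' = s
  | Inc c => s' = upd s c (s c).+1
  | Dec c => 0 < s c /\ s' = upd s c (s c).-1
  | Zero c => s c = 0 /\ s' = s
  end.

Inductive star (T : Type) (R : T -> T -> Prop) (s : T) : T -> Prop :=
  | StarRefl : star R s s
  | StarStep s1 s' : R s s1 -> star R s1 s' -> star R s s'.

Fixpoint den (e : prog) (s s' : nat -> nat) : Prop :=
  match e with
  | Act o => op_rel o s s'
  | Seq e1 e2 => exists2 s1, den e1 s s1 & den e2 s1 s'
  | Star e1 => star (den e1) s s'
  end.

Lemma den_Seq e1 e2 s s' :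
  den (Seq e1 e2) s s' -> exists2 s1, den e1 s s1 & den e2 s1 s'.
Proof. by []. Qed.

Lemma upd_same s c v : upd s c v c = v.
Proof. by rewrite /upd eqxx. Qed.

Lemma upd_other s c v r : r <> c -> upd s c v r = s r.
Proof. by rewrite /upd; case: eqP. Qed.

Definition loop (c : nat) (e : prog) : prog :=
  Seq (Star (Seq (Act (Dec c)) e)) (Act (Zero c)).

Lemma loop_sound (I : (nat -> nat) -> Prop) c e s s' :
    (forall s1 s2, I s1 -> 0 < s1 c -> den e (upd s1 c (s1 c).-1) s2 -> I s2) ->
  I s -> den (loop c e) s s' -> I s' /\ s' c = 0.
Proof.
move=> step Is [s1 run [z ->]]; split=> //.
elim: run Is {z} => {s s1 s'} // s s1 s' [s2 [c0 ->]] e1 _ IH Is.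
exact: IH (step _ _ Is c0 e1).
Qed.

(** The counter [c] is its own variant: each round must leave it exactly one lower, so induction on
    a bound for it reaches the exit test. *)
Lemma loop_complete (I : (nat -> nat) -> Prop) c e s :
    (forall s1, I s1 -> 0 < s1 c -> exists s2,
      [/\ den e (upd s1 c (s1 c).-1) s2, I s2 & s2 c = (s1 c).-1]) ->
  I s -> exists s', den (loop c e) s s'.
Proof.
move=> step; have [k] := ubnP (s c); elim: k s => // k IH s le_k Is.
case: (posnP (s c)) => [c0|c0]; first by exists s, s => //; apply: StarRefl.
have [s1 [e1 I1 c1]] := step _ Is c0.
have [||s' [s2 run z]] := IH s1 => //; first by lia.
exists s', s2 => //; apply: StarStep run; by exists (upd s c (s c).-1).
Qed.

Definition clear (c : nat) : prog := loop c (Act Nop).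

Lemma clear_sound c s s' :
  den (clear c) s s' -> s' c = 0 /\ forall r, r <> c -> s' r = s r.
Proof.
move/(@loop_sound (fun s1 => forall r, r <> c -> s1 r = s r)) => [] //.
by move=> s1 s2 I1 _ -> r rc; rewrite upd_other ?I1.
Qed.

Lemma clear_complete c s : exists s', den (clear c) s s'.
Proof.
apply: (@loop_complete (fun=> True)) => // s1 _ _.
by exists (upd s1 c (s1 c).-1); rewrite upd_same.
Qed.

(* The counter [t] is scratch space, needed to restore [x]. *)
Definition copy (x d t : nat) : prog :=
  Seq (clear d) (Seq (clear t)
    (Seq (loop x (Seq (Act (Inc d)) (Act (Inc t)))) (loop t (Act (Inc x))))).

Lemma copy_sound x d t s s' : x <> d -> x <> t -> d <> t ->
  den (copy x d t) s s' ->
  s' d = s x /\ forall r, r <> d -> r <> t -> s' r = s r.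
Proof.
move=> xd xt dt /den_Seq[s1 /clear_sound[d1 E1]].
move=> /den_Seq[s2 /clear_sound[t2 E2] /den_Seq[s3 L3 L4]].
(* Every unit taken from [x] goes into both [d] and [t], so each keeps a constant sum with [x]; the
   second loop then pours [t] back into [x]. *)
have [||[I3 J3 K3] Z3] := @loop_sound (fun u =>
  [/\ u d + u x = s x, u t + u x = s x &
      forall r, r <> d -> r <> t -> r <> x -> u r = s r]) _ _ _ _ _ _ L3.
- move=> u v [I J K] x0 [w -> ->]; split; rewrite /upd.
  + by rewrite !eqxx; do ![case: eqP => //]; lia.
  + by rewrite !eqxx; do ![case: eqP => //]; lia.
  + by move=> r rd rt rx; do ![case: eqP => //] => *; rewrite K.
- split; first by rewrite E2 // d1 E2 // E1.
  + by rewrite t2 E2 // E1.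
  + by move=> r rd rt rx; rewrite E2 // E1.
have [||[I4 J4 K4] Z4] := @loop_sound (fun u =>
  [/\ u d = s x, u t + u x = s x &
      forall r, r <> d -> r <> t -> r <> x -> u r = s r]) _ _ _ _ _ _ L4.
- move=> u v [I J K] t0 ->; split; rewrite /upd.
  + by do ![case: eqP => //]; lia.
  + by rewrite !eqxx; do ![case: eqP => //]; lia.
  + by move=> r rd rt rx; do ![case: eqP => //] => *; rewrite K.
- by split=> //; lia.
split=> // r rd rt; have [->|/eqP rx] := eqVneq r x; first by lia.
exact: K4.
Qed.

Lemma copy_complete x d t s : x <> d -> x <> t -> d <> t ->
  exists s', den (copy x d t) s s'.
Proof.
move=> xd xt dt; have [s1 D1] := clear_complete d s.
have [s2 D2] := clear_complete t s1.
have [||s3 D3] :=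
  @loop_complete (fun=> True) x (Seq (Act (Inc d)) (Act (Inc t))) s2.
- move=> u _ x0; eexists; split; [by eexists; exact: erefl|by []|].
  by rewrite upd_other // upd_other // upd_same.
- by [].
have [||s4 D4] := @loop_complete (fun=> True) t (Act (Inc x)) s3.
- move=> u _ t0; eexists; split; [exact: erefl|by []|].
  by rewrite upd_other ?upd_same // => /esym.
- by [].
by exists s4, s1 => //; exists s2 => //; exists s3.
Qed.

(** * Compiling recursive functions to counter programs *)

(* The arguments of [f] are read from the counters [a], all of them below [b];
   the value is left in [b], and the counters below [b] are preserved. *)
Fixpoint compile n (f : recfun n) : n.-tuple nat -> nat -> prog :=
  match f in recfun n return n.-tuple nat -> nat -> prog with
  | RZero _ => fun _ b => clear b
  | RSucc => fun a b => Seq (copy (thead a) b b.+1) (Act (Inc b))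
  | RProj _ i => fun a b => copy (tnth a i) b b.+1
  | RComp m _ f g => fun a b =>
      foldr (fun i e => Seq (compile (g i) a (b.+1 + i)) e)
        (Seq (compile f [tuple b.+1 + i | i < m] (b.+1 + m))
             (copy (b.+1 + m) b (b.+1 + m).+1))
        (enum 'I_m)
  | RPrim _ f g => fun a b =>
      Seq (copy (thead a) b.+2 b.+3) (Seq (clear b.+1)
        (Seq (compile f [tuple of behead a] b.+3) (Seq (copy b.+3 b b.+4)
          (loop b.+2
            (Seq (compile g [tuple of b.+1 :: b :: behead a] b.+3)
              (Seq (copy b.+3 b b.+4) (Act (Inc b.+1))))))))
  | RMu _ f => fun a b =>
      let call := compile f [tuple of b :: a] b.+1 in
      Seq (clear b)
        (Seq (Star (Seq call (Seq (Act (Dec b.+1)) (Act (Inc b)))))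
             (Seq call (Act (Zero b.+1))))
  end.

(** Programs are nondeterministic: every completed run must be correct, but only one completed run
    need exist. As [s] is arbitrary, scratch counters may start with any content. *)
Definition implements n (f : recfun n) (a : n.-tuple nat) b (e : prog) : Prop :=
  forall s,
    (forall s', den e s s' ->
      (forall r, r < b -> s' r = s r) /\ computes f (map_tuple s a) (s' b)) /\
    (forall y, computes f (map_tuple s a) y -> exists s', den e s s').

Lemma eq_map_tuple n (s s' : nat -> nat) (a : n.-tuple nat) (b : nat) :
    all (fun r => r < b) a -> (forall r, r < b -> s' r = s r) ->
  map_tuple s' a = map_tuple s a.
Proof.
move=> ab E; apply: val_inj => /=; apply/eq_in_map => r ra.
by apply: E; apply: (allP ab).
Qed.

Lemma map_behead n (s : nat -> nat) (a : n.+1.-tuple nat) :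
  [tuple of behead (map_tuple s a)] = map_tuple s [tuple of behead a].
Proof. by apply: val_inj; rewrite /= behead_map. Qed.

Lemma map_thead n (s : nat -> nat) (a : n.+1.-tuple nat) :
  thead (map_tuple s a) = s (thead a).
Proof. by rewrite /thead tnth_map. Qed.

Lemma prim_graph_fun (F : nat -> Prop) (G : nat -> nat -> nat -> Prop) :
    (forall y z, F y -> F z -> y = z) ->
    (forall k u y z, G k u y -> G k u z -> y = z) ->
  forall k y z, prim_graph F G k y -> prim_graph F G k z -> y = z.
Proof.
move=> Ff Gf; elim=> [|k IH] y z /=; first exact: Ff.
by move=> [u ru gu] [v /(IH _ _ ru) <-]; apply: Gf gu.
Qed.

Lemma prim_graph_le F G k j y : prim_graph F G k y -> j <= k ->
  exists z, prim_graph F G j z.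
Proof.
elim: k y => [|k IH] y /=; first by rewrite leqn0 => ? /eqP->; exists y.
move=> [z rz gz]; rewrite leq_eqVlt => /orP[/eqP->|]; last exact: IH rz.
by exists y, z.
Qed.

Lemma compile_zero n (a : n.-tuple nat) b :
  implements (RZero n) a b (compile (RZero n) a b).
Proof.
move=> s; split=> [s' /clear_sound[z E]|y _] /=; last exact: clear_complete.
by split=> // r rb; apply: E; lia.
Qed.

Lemma compile_succ (a : 1.-tuple nat) b : all (fun r => r < b) a ->
  implements RSucc a b (compile RSucc a b).
Proof.
move=> /allP /(_ _ (mem_tnth ord0 a)) /= ab s; split=> [s'|y _] /=.
  move=> [s1 /copy_sound []]; rewrite /thead; try lia.
  move=> E1 E2 ->; split=> [r rb|]; last by rewrite upd_same E1 tnth_map.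
  by rewrite upd_other ?E2; lia.
have [||| s1 D] := @copy_complete (thead a) b b.+1 s; rewrite /thead; try lia.
by eexists; exists s1.
Qed.

Lemma compile_proj n (i : 'I_n) (a : n.-tuple nat) b : all (fun r => r < b) a ->
  implements (RProj i) a b (compile (RProj i) a b).
Proof.
move=> /allP /(_ _ (mem_tnth i a)) /= ab s; split=> [s'|y _] /=.
  move=> /copy_sound []; try lia.
  move=> E1 E2; split=> [r rb|]; last by rewrite E1 tnth_map.
  by rewrite ?E2; lia.
by apply: copy_complete; lia.
Qed.

(** The code of [g i] has base [b.+1 + i], so it preserves the results of the earlier components;
    what it leaves above its base is harmless, since later blocks work from any scratch content. *)
Lemma compile_comp m n (f : recfun m) (g : 'I_m -> recfun n) :
    (forall (a : _.-tuple nat) b, all (fun r => r < b) a ->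
      implements f a b (compile f a b)) ->
    (forall i (a : _.-tuple nat) b, all (fun r => r < b) a ->
      implements (g i) a b (compile (g i) a b)) ->
  forall (a : _.-tuple nat) b, all (fun r => r < b) a ->
  implements (RComp f g) a b (compile (RComp f g) a b).
Proof.
move=> IHf IHg a b ab s /=; set rest := Seq _ _.
have abi i : all (fun r => r < b.+1 + i) a.
  by apply: sub_all ab => r; by move=> rb; rewrite ltn_addr // ltnW.
have sorted_m : sorted ltn (map val (enum 'I_m)).
  by rewrite val_enum_ord iota_ltn_sorted.
(* Induction over the list [l] of remaining components, with [s1] the state in which the call of [f]
   begins. Sortedness puts the remaining bases above the results already stored. *)
have fold_sound l s0 s' : sorted ltn (map val l) ->
    (forall r, r < b -> s0 r = s r) ->
    den (foldr (fun i e => Seq (compile (g i) a (b.+1 + i)) e) rest l) s0 s' ->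
  exists s1, [/\ den rest s1 s',
    forall r, all (fun i : 'I_m => r < b.+1 + i) l -> s1 r = s0 r &
    forall i, i \in l -> computes (g i) (map_tuple s a) (s1 (b.+1 + i))].
- elim: l s0 => [|i l IH] s0; first by move=> _ E0 D; exists s0.
  rewrite [map _ _]/= => srt E0 [s1 /(proj1 (IHg i _ _ (abi i) _)) [E1 c1] D].
  have [||s2 [D2 E2 c2]] := IH s1 _ _ D; first exact: path_sorted srt.
    by move=> r rb; rewrite E1 ?E0 // ltn_addr // ltnW.
  exists s2; split=> //= [r /andP[ri rl]|j]; first by rewrite E2 // E1.
  rewrite inE => /predU1P[->|/c2] //; rewrite E2; last first.
    have:= order_path_min ltn_trans srt; rewrite all_map.
    by apply: sub_all => k /=; rewrite ltn_add2l.
  by rewrite -(eq_map_tuple ab E0).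
have fold_complete l s0 : sorted ltn (map val l) ->
    (forall r, r < b -> s0 r = s r) ->
    (forall i, i \in l -> exists y, computes (g i) (map_tuple s a) y) ->
    (forall s1, (forall r, r < b -> s1 r = s r) ->
      (forall r, all (fun i : 'I_m => r < b.+1 + i) l -> s1 r = s0 r) ->
      (forall i, i \in l -> computes (g i) (map_tuple s a) (s1 (b.+1 + i))) ->
      exists s', den rest s1 s') ->
  exists s',
    den (foldr (fun i e => Seq (compile (g i) a (b.+1 + i)) e) rest l) s0 s'.
- elim: l s0 => [|i l IH] s0 srt E0 cg crest; first exact: crest.
  have [y cy] := cg i (mem_head _ _).
  have [sound cpl] := IHg i _ _ (abi i) s0.
  rewrite (eq_map_tuple ab E0) in cpl sound; have [s1 D1] := cpl _ cy.
  have [E1 c1] := sound _ D1.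
  have E1' r : r < b -> s1 r = s r.
    by move=> rb; rewrite E1 ?E0 // ltn_addr // ltnW.
  have [||||s' D'] := IH s1 => //; first exact: path_sorted srt.
  + by move=> j jl; apply: cg; rewrite inE jl orbT.
  + move=> s2 E2 F2 c2; apply: crest => //= [r /andP[ri rl]|j].
      by rewrite F2 // E1.
    rewrite inE => /predU1P[->|/c2] //; rewrite F2 //.
    have:= order_path_min ltn_trans srt; rewrite all_map.
    by apply: sub_all => k /=; rewrite ltn_add2l.
  by exists s', s1.
have abm : all (fun r => r < b.+1 + m) [tuple b.+1 + i | i < m].
  by apply/allP => r /mapP[i _ ->]; rewrite ltn_add2l.
have map_ws s1 i :
    tnth (map_tuple s1 [tuple b.+1 + i | i < m]) i = s1 (b.+1 + i).
  by rewrite tnth_map tnth_mktuple.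
split=> [s' /fold_sound[] // s1 [[s2 D2 D3] E1 c1]|y [w cw cf]].
  have [E2 c2] := proj1 (IHf _ _ abm s1) _ D2.
  have mem i : i \in enum 'I_m by rewrite mem_enum.
  have Em r : r < b -> s1 r = s r.
    by move=> rb; apply: E1; apply/allP => i _; rewrite ltn_addr // ltnW.
  split=> [r rb|].
    move/copy_sound: D3 => -[]; try lia; move=> _ ->; try lia.
    by rewrite E2; first exact: Em; lia.
  move/copy_sound: D3 => -[]; try lia; move=> -> _.
  exists (map_tuple s1 [tuple b.+1 + i | i < m]) => // i.
  by rewrite map_ws; apply: c1.
apply: fold_complete => // [i _|s1 E1 _ c1]; first by exists (tnth w i).
(* Determinacy of [computes] identifies the stored results with the given tuple [w]. *)
have ws : map_tuple s1 [tuple b.+1 + i | i < m] = w.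
  apply: eq_from_tnth => i; rewrite map_ws.
  by apply: computes_fun (cw i); apply: c1; rewrite mem_enum.
have [|s2 D2] := proj2 (IHf _ _ abm s1) y; first by rewrite ws.
have [||| s3 D3] := @copy_complete (b.+1 + m) b (b.+1 + m).+1 s2; try lia.
by exists s3, s2.
Qed.

Lemma compile_prim n (f : recfun n) (g : recfun n.+2) :
    (forall (a : _.-tuple nat) b, all (fun r => r < b) a ->
      implements f a b (compile f a b)) ->
    (forall (a : _.-tuple nat) b, all (fun r => r < b) a ->
      implements g a b (compile g a b)) ->
  forall (a : _.-tuple nat) b, all (fun r => r < b) a ->
  implements (RPrim f g) a b (compile (RPrim f g) a b).
Proof.
move=> IHf IHg a b ab s.
rewrite [compile _ _ _]/= [computes _ _]/= map_thead map_behead.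
pose F := computes f (map_tuple s [tuple of behead a]).
pose G k z := computes g [tuple of k :: z :: behead (map_tuple s a)].
rewrite -/F -/G; set body := Seq _ (Seq _ (Act _)).
have a0b : thead a < b by move/allP: ab => /(_ _ (mem_tnth ord0 a)).
have bab : all (fun r => r < b) (behead a).
  by apply/allP => r /mem_behead; apply: (allP ab).
have fb : all (fun r => r < b.+3) [tuple of behead a].
  by apply: sub_all bab => r /=; lia.
have gb : all (fun r => r < b.+3) [tuple of b.+1 :: b :: behead a].
  by rewrite /= fb; lia.
have Ff y z : F y -> F z -> y = z by apply: computes_fun.
have Gf k u y z : G k u y -> G k u z -> y = z by apply: computes_fun.
(* [loop] decrements [b.+2] before the body is entered; the arguments of [g] avoid that counter. *)
have args u k : (forall r, r < b -> u r = s r) ->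
    map_tuple (upd u b.+2 k) [tuple of b.+1 :: b :: behead a] =
    [tuple of u b.+1 :: u b :: behead (map_tuple s a)].
  move=> E; apply: val_inj => /=; rewrite !upd_other; try lia.
  congr [:: _, _ & _]; rewrite !behead_map; apply/eq_in_map => r ra.
  by have /= rb := allP bab _ ra; rewrite upd_other ?E //; lia.
(* Here [b.+2] holds the rounds left, [b.+1] the rounds done and [b] the value reached so far. *)
pose I u := [/\ forall r, r < b -> u r = s r,
  u b.+1 + u b.+2 = s (thead a) & prim_graph F G (u b.+1) (u b)].
have body_sound u v : I u -> 0 < u b.+2 ->
    den body (upd u b.+2 (u b.+2).-1) v -> I v /\ v b.+2 = (u b.+2).-1.
  move=> [Iu Xu Pu] u0 /den_Seq[s1 /(proj1 (IHg _ _ gb _)) [E1]].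
  rewrite args // => c1 /den_Seq[s2 /copy_sound[]]; try lia.
  move=> E2 F2 ->; have v1 : s2 b.+1 = u b.+1.
    by rewrite F2; try lia; rewrite E1 ?upd_other //; lia.
  have v2 : s2 b.+2 = (u b.+2).-1.
    by rewrite F2; try lia; rewrite E1 ?upd_same //; lia.
  split; last by rewrite upd_other ?v2 //; lia.
  split=> [r rb||].
  - rewrite upd_other; last by lia.
    rewrite F2; try lia; rewrite E1; try lia.
    by rewrite upd_other ?Iu //; lia.
  - by rewrite upd_same upd_other; last lia; rewrite v1 v2; lia.
  - by rewrite upd_same upd_other; last lia; rewrite v1 E2; exists (u b).
have start_sound s1 s2 s3 s4 : den (copy (thead a) b.+2 b.+3) s s1 ->
    den (clear b.+1) s1 s2 -> den (compile f [tuple of behead a] b.+3) s2 s3 ->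
    den (copy b.+3 b b.+4) s3 s4 -> I s4.
  move=> /copy_sound[]; try lia; move=> E1 F1 /clear_sound[E2 F2].
  have Es r : r < b -> s2 r = s r.
    by move=> rb; rewrite F2 ?F1 //; lia.
  move=> /(proj1 (IHf _ _ fb _)) [E3]; rewrite (eq_map_tuple bab Es) => c3.
  move=> /copy_sound[]; try lia; move=> E4 F4; split=> [r rb||].
  - by rewrite F4; try lia; rewrite E3 ?Es //; lia.
  - by rewrite !F4; try lia; rewrite !E3 ?E2 ?F2 ?E1 //; lia.
  - by rewrite F4; try lia; rewrite E3 ?E2 ?E4.
split=> [s'|y Py].
  move=> /den_Seq[s1 D1 /den_Seq[s2 D2 /den_Seq[s3 D3 /den_Seq[s4 D4]]]].
  have I4 := start_sound _ _ _ _ D1 D2 D3 D4.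
  move=> /(loop_sound (I := I)) [] //.
    by move=> u v Iu u0 /(body_sound _ _ Iu u0) [].
  by move=> [Es' Xs' Ps'] z; split=> //; rewrite -Xs' z addn0.
have [||| s1 D1] := @copy_complete (thead a) b.+2 b.+3 s; try lia.
have [s2 D2] := clear_complete b.+1 s1.
have Es r : r < b -> s2 r = s r.
  move/clear_sound: D2 => [_ F2] rb; rewrite F2; last lia.
  by move/copy_sound: D1 => []; try lia; move=> _ ->; lia.
have [s3 D3] : exists s3, den (compile f [tuple of behead a] b.+3) s2 s3.
  have [z] := prim_graph_le Py (leq0n _); rewrite /= /F -(eq_map_tuple bab Es).
  exact: (proj2 (IHf _ _ fb _)).
have [||| s4 D4] := @copy_complete b.+3 b b.+4 s3; try lia.
have I4 := start_sound _ _ _ _ D1 D2 D3 D4.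
have [u Iu u0|//|s' D'] := @loop_complete I b.+2 body s4; last first.
  by exists s', s1 => //; exists s2 => //; exists s3 => //; exists s4.
suff [v Dv] : exists v, den body (upd u b.+2 (u b.+2).-1) v.
  by have [] := body_sound _ _ Iu u0 Dv; exists v.
have [Eu Xu Pu] := Iu.
(* A round is left, so the next stage lies within the recursion argument and has a value;
   determinacy then equates its predecessor value with [u b]. *)
have [|z' [z Pz gz]] := @prim_graph_le F G _ (u b.+1).+1 _ Py; first lia.
have uz := prim_graph_fun Ff Gf Pu Pz.
rewrite -{}uz /G -(args _ (u b.+2).-1) // in gz.
have [v1 D5] := proj2 (IHg _ _ gb _) _ gz.
have [||| v2 D6] := @copy_complete b.+3 b b.+4 v1; try lia.
by eexists; exists v1 => //; exists v2.
Qed.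

(** [b] holds the candidate and [b.+1] the value of [f] at it. [Dec b.+1] admits another round only
    for a nonzero value and [Zero b.+1] the exit only for zero, so the nondeterministic star can
    only stop at the least zero. *)
Lemma compile_mu n (f : recfun n.+1) :
    (forall (a : _.-tuple nat) b, all (fun r => r < b) a ->
      implements f a b (compile f a b)) ->
  forall (a : _.-tuple nat) b, all (fun r => r < b) a ->
  implements (RMu f) a b (compile (RMu f) a b).
Proof.
move=> IHf a b ab s; rewrite [compile _ _ _]/=; set call := compile f _ _.
have fb : all (fun r => r < b.+1) [tuple of b :: a].
  by rewrite /= ltnSn; apply: sub_all ab => r; apply: ltnW.
have args u : (forall r, r < b -> u r = s r) ->
    map_tuple u [tuple of b :: a] = [tuple of u b :: map_tuple s a].
  move=> E; apply: val_inj => /=; congr (_ :: _); apply/eq_in_map => r ra.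
  by apply: E; apply: (allP ab).
have call_sound u v : (forall r, r < b -> u r = s r) -> den call u v ->
    (forall r, r <= b -> v r = u r) /\
    computes f [tuple of u b :: map_tuple s a] (v b.+1).
  by move=> E /(proj1 (IHf _ _ fb _)); rewrite args.
have call_complete u y : (forall r, r < b -> u r = s r) ->
    computes f [tuple of u b :: map_tuple s a] y -> exists v, den call u v.
  by move=> E; rewrite -args //; apply: (proj2 (IHf _ _ fb _)).
pose I u := (forall r, r < b -> u r = s r) /\
  forall k, k < u b -> exists z, computes f [tuple of k :: map_tuple s a] z.+1.
have body_sound u v1 : I u -> den call u v1 -> 0 < v1 b.+1 ->
    I (upd (upd v1 b.+1 (v1 b.+1).-1) b (v1 b).+1).
  move=> [Eu Cu] /(call_sound _ _ Eu) [E1 c1] v0; split=> [r rb|k].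
    by rewrite !upd_other ?E1 ?Eu //; lia.
  rewrite upd_same E1 // ltnS leq_eqVlt => /orP[/eqP->|/Cu //].
  by exists (v1 b.+1).-1; rewrite prednK.
split=> [s'|y [c0 cy]].
  move=> /den_Seq[s1 /clear_sound[z1 E1] /den_Seq[s2 loop_run]].
  move=> /den_Seq[s3 Dcall [z ->]].
  have [Es2 Cs2] : I s2.
    have : I s1 by split=> [r rb|k]; [rewrite E1 //; lia | rewrite z1].
    elim: loop_run => // u v w [v1 D1 [v2 [v0 ->] ->]] _ IH Iu.
    by apply: IH; rewrite upd_other; [apply: body_sound D1 v0 | lia].
  have [E3 c3] := call_sound _ _ Es2 Dcall.
  rewrite z in c3; split=> [r rb|/=]; first by rewrite E3 ?Es2 // ltnW.
  by rewrite E3.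
have [s1 D1] := clear_complete b s; have [z1 E1] := clear_sound D1.
suff: exists s', den (Seq (Star (Seq call (Seq (Act (Dec b.+1)) (Act (Inc b)))))
                          (Seq call (Act (Zero b.+1)))) s1 s'.
  by move=> [s' D']; exists s', s1.
have : s1 b <= y by rewrite z1.
have {D1 z1} : forall r, r < b -> s1 r = s r by move=> r rb; apply: E1; lia.
(* Induction on the distance from the candidate to the least zero [y]. *)
have [k] := ubnP (y - s1 b); elim: k s1 {E1} => // k IH u le_k Eu.
rewrite leq_eqVlt => /orP[/eqP ub|ub].
  rewrite -ub in c0; have [v D] := call_complete _ _ Eu c0.
  have [Ev cv] := call_sound _ _ Eu D.
  exists v, u; first exact: StarRefl.
  by exists v => //; split=> //; apply: computes_fun cv c0.
have [z cz] := cy _ ub; have [v D] := call_complete _ _ Eu cz.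
have [Ev cv] := call_sound _ _ Eu D; have vz := computes_fun cv cz.
set w := upd (upd v b.+1 (v b.+1).-1) b (v b).+1.
have wb : w b = (u b).+1 by rewrite /w upd_same Ev.
have [|r rb||s' [w' Dw Dw']] := IH w; rewrite ?wb //; first by lia.
  by rewrite /w !upd_other ?Ev ?Eu //; lia.
exists s', w' => //; apply: StarStep Dw; exists v => //.
exists (upd v b.+1 (v b.+1).-1); first by split; rewrite ?vz.
by rewrite /= upd_other; last lia.
Qed.

Theorem compileP n (f : recfun n) (a : n.-tuple nat) b :
  all (fun r => r < b) a -> implements f a b (compile f a b).
Proof.
elim: f a b => {n} [n||n i|m n f IHf g IHg|n f IHf g IHg|n f IHf] a b ab.
- exact: compile_zero.
- exact: compile_succ.
- exact: compile_proj.
- exact: compile_comp.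
- exact: compile_prim.
- exact: compile_mu.
Qed.

(** * Goto machines *)

(* The instruction [(o, t1, t2)] performs [o], then jumps to [t1] or to [t2]. *)
Definition instr : Type := op * nat * nat.

(** It sits at location 0 of every [machine], where it jumps to itself, and is the default of
    [nth]. *)
Definition halt : instr := (Nop, 0, 0).

Fixpoint plen (e : prog) : nat :=
  match e with
  | Act _ => 1
  | Seq e1 e2 => plen e2 + plen e1
  | Star e1 => (plen e1).+2
  end.

(* Control flows downwards: [code e p] occupies the locations [p + 1] to
   [p + plen e], is entered at the last one and left by a jump to [p].  With
   this layout prefixing a program by an instruction appends to its code. *)
Fixpoint code (e : prog) (p : nat) : seq instr :=
  match e with
  | Act o => [:: (o, p, p)]
  | Seq e1 e2 => code e2 p ++ code e1 (p + plen e2)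
  | Star e1 => let entry := p + (plen e1).+2 in
      [:: (Nop, entry, entry)] ++ code e1 p.+1 ++ [:: (Nop, p, p.+1 + plen e1)]
  end.

Lemma size_code e p : size (code e p) = plen e.
Proof.
elim: e p => [o|e1 IH1 e2 IH2|e IH] p //=; first by rewrite size_cat IH1 IH2.
by rewrite size_cat IH addn1.
Qed.

Definition mstep (P : seq instr) (c c' : nat * (nat -> nat)) : Prop :=
  c.1 < size P /\
  let: (o, t1, t2) := nth halt P c.1 in
  op_rel o c.2 c'.2 /\ (c'.1 = t1 \/ c'.1 = t2).

Fixpoint msteps P k c c' : Prop :=
  if k is k'.+1 then exists2 c1, mstep P c c1 & msteps P k' c1 c' else c = c'.

Lemma msteps_trans P j k c1 c2 c3 :
  msteps P j c1 c2 -> msteps P k c2 c3 -> msteps P (j + k) c1 c3.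
Proof.
elim: j c1 => [|j IH] c1 /=; first by move->.
by move=> [c s1 r1] r2; exists c => //; apply: IH r1 r2.
Qed.

Definition code_at (P : seq instr) (p : nat) (l : seq instr) : Prop :=
  exists l1 l2, P = l1 ++ l ++ l2 /\ size l1 = p.+1.

Lemma code_at_cat P p l1 l2 :
  code_at P p (l1 ++ l2) -> code_at P p l1 /\ code_at P (p + size l1) l2.
Proof.
move=> [A [B [-> sA]]]; split; first by exists A, (l2 ++ B); rewrite -catA.
by exists (A ++ l1), B; rewrite -!catA size_cat sA addSn.
Qed.

Lemma code_at1 P p i : code_at P p [:: i] ->
  p.+1 < size P /\ nth halt P p.+1 = i.
Proof.
move=> [A [B [-> sA]]]; rewrite !size_cat /= nth_cat sA ltnn subnn.
by split=> //; lia.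
Qed.

Lemma code_complete P e p s s' : code_at P p (code e p) -> den e s s' ->
  exists k, msteps P k (p + plen e, s) (p, s').
Proof.
elim: e p s s' => [o|e1 IH1 e2 IH2|e IH] p s s'; cbn [code plen].
- move=> /code_at1[lt_p E] ss'; exists 1, (p, s') => //=.
  by rewrite addn1; split; rewrite //= E; split; [exact: ss'|left].
- move=> /code_at_cat[at2]; rewrite size_code => at1 [s1 D1 D2].
  have [k1 r1] := IH1 _ _ _ at1 D1; have [k2 r2] := IH2 _ _ _ at2 D2.
  by exists (k1 + k2); rewrite addnA; apply: msteps_trans r1 r2.
- move=> /(@code_at_cat _ _ [:: _])[/code_at1[lt0 E0] /code_at_cat[]].
  rewrite [size _]/= addn1 size_code => ate /code_at1[lt1 E1].
  (* The top instruction of a star chooses between the exit [p] and the top of the body; the body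
     exits to [p.+1], which jumps back to this choice. *)
  have step_entry q u : q = p \/ q = p.+1 + plen e ->
      mstep P (p + (plen e).+2, u) (q, u).
    by rewrite !addnS -addSn; split; rewrite /= -?addSn // E1 /=; case: H; auto.
  move=> D; have {D} : star (den e) s s' := D.
  elim=> {s s'} [s|s s1 s' D _ [k r]].
    by exists 1, (p, s) => //; apply: step_entry; left.
  have [j rj] := IH p.+1 _ _ ate D.
  exists (1 + (j + (1 + k))); apply: msteps_trans.
    by exists (p.+1 + plen e, s); [apply: step_entry; right|].
  apply: msteps_trans rj _; exists (p + (plen e).+2, s1) => //.
  by split; rewrite //= E0; split=> //; left.
Qed.

(** Control can leave a block only through its exit [p]. The bound [k' < k] lets the star case go by
    strong induction on the length of the run. *)
Lemma code_sound P e p q k s s' : code_at P p (code e p) ->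
    ~~ (p < q <= p + plen e) -> msteps P k (p + plen e, s) (q, s') ->
  exists k' s1, [/\ k' < k, den e s s1 & msteps P k' (p, s1) (q, s')].
Proof.
elim: e p k s => [o|e1 IH1 e2 IH2|e IH] p k s; cbn [code plen].
- rewrite addn1 => /code_at1[lt_p E] qp; case: k => [[q' _]|k].
    by rewrite -q' ltnSn in qp.
  move=> [[q1 s1] [/= _]]; rewrite E => -[o1 q1p] r.
  by exists k, s1; split=> //; case: q1p => <-.
- move=> /code_at_cat[at2]; rewrite size_code addnA => at1 qp r.
  have [|k1 [s1 [lt1 D1 r1]]] := IH1 _ _ _ at1 _ r; first by lia.
  have [|k2 [s2 [lt2 D2 r2]]] := IH2 _ _ _ at2 _ r1; first by lia.
  by exists k2, s2; split=> //; [lia | exists s1].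
- move=> /(@code_at_cat _ _ [:: _])[/code_at1[lt0 E0] /code_at_cat[]].
  rewrite [size _]/= addn1 size_code => ate /code_at1[lt1 E1] qp.
  have [n] := ubnP k; elim: n k s => // n IHn [|k] s le_n.
    by move=> [q' _]; lia.
  move=> [[q1 s1] [/= _]]; rewrite !addnS -addSn E1 => -[->].
  case=> ->; first by move=> r; exists k, s; split=> //; apply: StarRefl.
  move=> /(IH _ _ _ ate) [|k1 [s2 [lt_k1 D r1]]]; first by lia.
  case: k1 lt_k1 r1 => [|k1] lt_k1; first by move=> [q' _]; lia.
  move=> [[q2 s3] [/= _]]; rewrite E0 => -[->] q2E.
  have {q2E} -> : q2 = p + (plen e).+2 by case: q2E.
  move=> /IHn[|k2 [s4 [lt_k2 D4 r4]]]; first by lia.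
  by exists k2, s4; split=> //; [lia | apply: StarStep D4].
Qed.

Definition machine (e : prog) : seq instr := halt :: code e 0.

Lemma machineP e s :
  (exists k s', msteps (machine e) k (plen e, s) (0, s')) <->
  (exists s', den e s s').
Proof.
have at0 : code_at (machine e) 0 (code e 0).
  by exists [:: halt], [::]; rewrite cats0.
split=> [[k [s' r]]|[s' D]].
  by have [|_ [s1 [_ D _]]] := code_sound at0 _ r; [lia | exists s1].
by have [k r] := code_complete at0 D; exists k, s'.
Qed.

Definition op_ok (M : nat) (o : op) : bool :=
  match o with Nop => true | Inc c | Dec c | Zero c => c <= M end.

Definition instr_ok (M K : nat) (i : instr) : bool :=
  [&& op_ok M i.1.1, i.1.2 <= K & i.2 <= K].

Fixpoint prog_ok (M : nat) (e : prog) : bool :=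
  match e with
  | Act o => op_ok M o
  | Seq e1 e2 => prog_ok M e1 && prog_ok M e2
  | Star e1 => prog_ok M e1
  end.

Lemma code_ok M e p : prog_ok M e -> all (instr_ok M (p + plen e)) (code e p).
Proof.
have mono K K' l : K <= K' -> all (instr_ok M K) l -> all (instr_ok M K') l.
  move=> le_K; apply: sub_all => i /and3P[? ? ?].
  by apply/and3P; split=> //; lia.
elim: e p => [o|e1 IH1 e2 IH2|e IH] p; cbn [code plen prog_ok].
- by rewrite /instr_ok /= => ->; lia.
- move=> /andP[ok1 ok2]; rewrite all_cat (mono _ _ _ _ (IH2 p ok2)); last lia.
  by rewrite (mono _ _ _ _ (IH1 _ ok1)) //; lia.
- move=> ok; rewrite !all_cat (mono _ _ _ _ (IH p.+1 ok)); last lia.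
  by rewrite /instr_ok /=; lia.
Qed.

Fixpoint maxreg (e : prog) : nat :=
  match e with
  | Act (Inc c) | Act (Dec c) | Act (Zero c) => c
  | Act Nop => 0
  | Seq e1 e2 => maxn (maxreg e1) (maxreg e2)
  | Star e1 => maxreg e1
  end.

Lemma prog_okP M e : maxreg e <= M -> prog_ok M e.
Proof.
elim: e => [[|c|c|c]|e1 IH1 e2 IH2|e IH] //=.
by rewrite geq_max => /andP[/IH1-> /IH2->].
Qed.

(** * Dual-reference programs simulating goto machines *)

Definition same M k (r : role) (x : nat) : formula M.+1 k (role * stage) :=
  let v := FVar (r, Current) (inord x) in
  let v' := FVar (r, Next) (inord x) in
  FOr (FAnd v v') (FAnd (FNot v) (FNot v')).

(** Recursion on the length, instead of an indexed conjunction, makes the Goedel number of this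
    formula a plain iteration. *)
Fixpoint keep M k (r : role) (lo len : nat) : formula M.+1 k (role * stage) :=
  if len is l.+1 then FAnd (keep M k r lo l) (same M k r (lo + l))
  else FConst true.

Definition keep_all M k r := keep M k r 0 M.+1.

Definition keep_but M k r (c : nat) :=
  FAnd (keep M k r 0 c) (keep M k r c.+1 (M - c)).

(* The value of the counter [c] is the number of threads whose variable [c] is
   true; the active thread is the one that is counted in or out. *)
Definition op_formula M k (o : op) : formula M.+1 k (role * stage) :=
  match o with
  | Nop => keep_all M k Active
  | Inc c => FAnd (FNot (FVar (Active, Current) (inord c)))
      (FAnd (FVar (Active, Next) (inord c))
            (keep_but M k Active c))
  | Dec c => FAnd (FVar (Active, Current) (inord c))
      (FAnd (FNot (FVar (Active, Next) (inord c)))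
            (keep_but M k Active c))
  | Zero c => FAnd (FNot (FVar (Active, Current) (inord c)))
      (FAnd (FNot (FVar (Passive, Current) (inord c)))
            (keep_all M k Active))
  end.

Definition instr_formula M K (q : nat) (i : instr) :
    formula M.+1 K.+1 (role * stage) :=
  let: (o, t1, t2) := i in
  FAnd (FAt (Active, Current) (inord q)) (FAnd (op_formula M K.+1 o)
    (FOr (FAt (Active, Next) (inord t1)) (FAt (Active, Next) (inord t2)))).

Fixpoint body M K (P : seq instr) (q : nat) :
    formula M.+1 K.+1 (role * stage) :=
  if q is q'.+1 then FOr (body M K P q') (instr_formula M K q' (nth halt P q'))
  else FConst false.

(** Imposed on each passive thread: its variables are frozen and its location follows the active
    thread, so all threads stay in one common location. *)
Definition frame M K : formula M.+1 K.+1 (role * stage) :=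
  FAnd (keep_all M K.+1 Passive) (FSame (Passive, Next) (Active, Next)).

Fixpoint zeros M K (len : nat) : formula M.+1 K.+1 role :=
  if len is l.+1 then
    FAnd (zeros M K l)
      (FAnd (FNot (FVar Active (inord l))) (FNot (FVar Passive (inord l))))
  else FConst true.

Definition start M K : formula M.+1 K.+1 role :=
  FAnd (FAt Active (inord K)) (FAnd (FAt Passive (inord K)) (zeros M K M.+1)).

Definition dr M K (P : seq instr) : drprog :=
  @DRProg M.+1 K.+1 (FAnd (frame M K) (body M K P (size P))) (start M K).

Section Holds.
Variables (m k : nat) (T : Type) (s : T -> lstate m k).

Lemma holds_rename (U : Type) (r : U -> T) (f : formula m k U) :
  holds s (rename r f) = holds (s \o r) f.
Proof. by elim: f => //= [f ->|f -> g ->|f -> g ->]. Qed.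

Lemma holds_big_and (I : finType) (D : pred I) F :
  holds s (\big[FAnd/FConst true]_(i | D i) F i) =
  [forall (i | D i), holds s (F i)].
Proof. by rewrite -big_andE; apply: big_morph. Qed.

Lemma holds_big_or (I : finType) (D : pred I) F :
  holds s (\big[FOr/FConst false]_(i | D i) F i) =
  [exists (i | D i), holds s (F i)].
Proof. by rewrite -big_orE; apply: big_morph. Qed.

End Holds.

Lemma holds_keep M k (E : role * stage -> lstate M.+1 k) r lo len :
    lo + len <= M.+1 ->
  reflect (forall x : 'I_M.+1, lo <= x < lo + len ->
             lvar (E (r, Next)) x = lvar (E (r, Current)) x)
          (holds E (keep M k r lo len)).
Proof.
elim: len => [|l IH] /= le_M; first by constructor=> x; lia.
rewrite addnS in le_M; have {}IH := IH (ltnW le_M).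
apply: (iffP andP) => [[/IH H /= Hl] x|H]; last first.
  split; first by apply/IH => x /andP[? ?]; apply: H; lia.
  rewrite H; first by case: (lvar _ _).
  by rewrite inordK; lia.
have [-> _|/eqP xl lt_x] := eqVneq x (inord (lo + l)).
  by move: Hl; case: (lvar _ _); case: (lvar _ _).
apply: H; suff : x <> lo + l :> nat by lia.
by move=> xE; apply: xl; rewrite -xE inord_val.
Qed.

Lemma holds_keep_all M k (E : role * stage -> lstate M.+1 k) r :
  reflect (forall x, lvar (E (r, Next)) x = lvar (E (r, Current)) x)
          (holds E (keep_all M k r)).
Proof.
have le_M : 0 + M.+1 <= M.+1 by [].
by apply: (iffP (holds_keep _ _ le_M)) => H x *; apply: H; rewrite ?ltn_ord.
Qed.

Lemma holds_keep_but M k (E : role * stage -> lstate M.+1 k) r c : c <= M ->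
  reflect (forall x, x != inord c ->
             lvar (E (r, Next)) x = lvar (E (r, Current)) x)
          (holds E (keep_but M k r c)).
Proof.
move=> le_c; have ltc : 0 + c <= M.+1 by lia.
have gtc : c.+1 + (M - c) <= M.+1 by lia.
apply: (iffP andP) => [[]|H].
  move=> /(holds_keep _ _ ltc) lo /(holds_keep _ _ gtc) hi x xc.
  have {}xc : x <> c :> nat.
    by move=> xE; move/eqP: xc; apply; rewrite -xE inord_val.
  have [xlt|xge] := ltnP x c; first exact: lo.
  by apply: hi; have := ltn_ord x; lia.
split; apply/holds_keep => // x lt_x; apply: H; apply/eqP=> xE; move: lt_x;
  by rewrite xE inordK; lia.
Qed.

Lemma holds_zeros M K (E : role -> lstate M.+1 K.+1) :
  reflect (forall r x, lvar (E r) x = false) (holds E (zeros M K M.+1)).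
Proof.
suff H len : len <= M.+1 ->
    reflect (forall r (x : 'I_M.+1), x < len -> lvar (E r) x = false)
            (holds E (zeros M K len)).
  by apply: (iffP (H _ _)) => // {}H r x *; apply: H.
elim: len => [|l IH] /= le_M; first by constructor.
have {}IH := IH (ltnW le_M).
apply: (iffP and3P) => [[/IH H a p] r x|H].
  rewrite ltnS leq_eqVlt => /orP[/eqP xl|]; last exact: H.
  by move: a p; rewrite -xl inord_val; case: r => /negbTE ? /negbTE ?.
split; first by apply/IH => r x lt_x; apply: H; apply: ltnW.
  by rewrite H // inordK.
by rewrite H // inordK.
Qed.

Lemma holds_body M K P q (E : role * stage -> lstate M.+1 K.+1) :
  reflect (exists2 j, j < q & holds E (instr_formula M K j (nth halt P j)))
          (holds E (body M K P q)).
Proof.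
elim: q => [|q IH] /=; first by constructor=> -[].
apply: (iffP orP) => [[/IH[j lt_j H]|H]|[j]].
- by exists j => //; apply: ltnW.
- by exists q.
- rewrite ltnS leq_eqVlt => /orP[/eqP->|lt_j] H; first by right.
  by left; apply/IH; exists j.
Qed.

Definition env n m k (s s' : 'I_n -> lstate m k) (a p : 'I_n)
    (t : role * stage) : lstate m k :=
  if t.2 is Current then s (thread a p t.1) else s' (thread a p t.1).

Lemma stepP (P : drprog) n (s s' : nstate P n) :
  reflect (exists a, forall p, p != a -> holds (env s s' a p) (trans P))
          (step s s').
Proof.
rewrite /step /transn holds_big_or.
apply: (iffP existsP) => -[a H]; exists a.
  move=> p pa; move: H; rewrite /= holds_big_and => /forall_inP /(_ p pa).
  by rewrite holds_rename.
rewrite /= holds_big_and; apply/forall_inP => p pa.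
by rewrite holds_rename; apply: H.
Qed.

Lemma initP (P : drprog) n (s : nstate P n) :
  reflect (exists a, forall p, p != a -> holds (s \o thread a p) (init P))
          (holds s (initn P n)).
Proof.
rewrite /initn holds_big_or; apply: (iffP existsP) => -[a H]; exists a.
  move=> p pa; move: H; rewrite /= holds_big_and => /forall_inP /(_ p pa).
  by rewrite holds_rename.
rewrite /= holds_big_and; apply/forall_inP => p pa.
by rewrite holds_rename; apply: H.
Qed.

(** With a second thread the conjunction over passive threads is nonempty, so the conditions on the
    active thread are in force. *)
Lemma exists_passive n (a : 'I_n) : 1 < n -> exists p : 'I_n, p != a.
Proof.
move=> n2; have n1 : 0 < n by lia.
have [<-|] := eqVneq (Ordinal n1) a; last by exists (Ordinal n1).
by exists (Ordinal n2).
Qed.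

Section Simulation.
Variables (M K : nat) (P : seq instr) (n : nat).
Hypothesis sizeP : size P = K.+1.
Hypothesis okP : all (instr_ok M K) P.

Local Notation state := ('I_n -> lstate M.+1 K.+1).

(** The value 0 above [M] makes this a full counter state, comparable pointwise with those of the
    machine. *)
Definition count (st : state) (r : nat) : nat :=
  if r <= M then #|[set i | lvar (st i) (inord r)]| else 0.

Definition at_loc (st : state) (q : nat) : Prop :=
  forall i, pc (st i) = q :> nat.

Lemma count_same (st st' : state) :
  (forall i x, lvar (st' i) x = lvar (st i) x) -> count st' =1 count st.
Proof.
move=> E r; rewrite /count; case: leqP => // _.
by congr #|pred_of_set _|; apply/setP => i; rewrite !inE E.
Qed.

(** Thread [a] alone joins the set being counted. A decrement is handled by exchanging the two
    states. *)
Lemma count_flip (st st' : state) a c : c <= M ->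
    lvar (st a) (inord c) = false -> lvar (st' a) (inord c) = true ->
    (forall i x, (i, x) != (a, inord c) -> lvar (st' i) x = lvar (st i) x) ->
  count st' =1 upd (count st) c (count st c).+1.
Proof.
move=> le_c F T E r; rewrite /upd /count; case: eqP => [->|/eqP rc].
  rewrite le_c -[RHS](_ : #|a |: [set i | lvar (st i) (inord c)]| = _).
    congr #|pred_of_set _|; apply/setP => i; rewrite !inE.
    have [->|ia] := eqVneq i a; first by rewrite T.
    by rewrite E // xpair_eqE negb_and ia.
  by rewrite cardsU1 inE F.
case: leqP => // le_r; congr #|pred_of_set _|; apply/setP => i.
rewrite !inE E //.
rewrite xpair_eqE negb_and; apply/orP; right; apply: contra rc => /eqP.
by move/(congr1 val); rewrite /= !inordK // => ->.
Qed.

Lemma nth_ok q : q <= K -> instr_ok M K (nth halt P q).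
Proof. by move=> le_q; apply: all_nthP => //; rewrite sizeP. Qed.

(** Counter states are functions known to agree only pointwise, so operations have to be transported
    along [=1]. *)
Lemma op_rel_ext o s t s' : s =1 t -> op_rel o s s' ->
  exists2 t', op_rel o t t' & s' =1 t'.
Proof.
have upd_ext c v : s =1 t -> upd s c v =1 upd t c v.
  by move=> E r; rewrite /upd E.
move=> E; case: o => [|c|c|c] /=.
- by move=> ->; exists t.
- by move=> ->; eexists; [exact: erefl | rewrite E; apply: upd_ext].
- move=> [s0 ->]; exists (upd t c (t c).-1); first by rewrite -E.
  by rewrite E; apply: upd_ext.
- by move=> [s0 ->]; exists t => //; rewrite -E.
Qed.

Lemma dr_step_sound (st st' : state) q s : 1 < n -> at_loc st q ->
    count st =1 s -> @step (dr M K P) n st st' ->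
  exists q' s', [/\ mstep P (q, s) (q', s'), at_loc st' q' & count st' =1 s'].
Proof.
move=> n2 Q Es /stepP[a H].
have lt_q : q < K.+1 by rewrite -(Q a).
(* Each passive thread could satisfy a different disjunct of [body], but every disjunct tests the
   location of the active thread, which forces [j = q]. *)
have {}H p : p != a ->
    [/\ forall x, lvar (st' p) x = lvar (st p) x, pc (st' p) = pc (st' a) &
        holds (env st st' a p) (instr_formula M K q (nth halt P q))].
  move=> /H /andP[/andP[/holds_keep_all same_p /eqP pc_p]] /holds_body[j].
  rewrite sizeP => lt_j Hj; split=> //.
  suff -> : q = j by [].
  move: Hj; case: (nth _ _ _) => [[o t1] t2] /= /andP[/eqP E _].
  by rewrite -(Q a) E inordK.
have [p0 p0a] := exists_passive a n2.
have := nth_ok lt_q; rewrite /mstep /= sizeP lt_q.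
case: (nth _ _ _) H => [[o t1] t2] H /and3P[/= ok_o le1 le2].
have [_ _ /and3P[_ _ pc_a]] := H p0 p0a.
have {}pc_a : pc (st' a) = t1 :> nat \/ pc (st' a) = t2 :> nat.
  by case/orP: pc_a => /eqP ->; rewrite inordK; auto.
have at' : at_loc st' (pc (st' a)).
  by move=> i; have [->//|/H[_ -> _]] := eqVneq i a.
have keep_p p x : p != a -> lvar (st' p) x = lvar (st p) x.
  by move=> /H[].
have {H} op_p p : p != a -> holds (env st st' a p) (op_formula M K.+1 o).
  by move=> /H[_ _ /and3P[]].
exists (pc (st' a)).
suff [s' os E] : exists2 s', op_rel o (count st) s' & count st' =1 s'.
  have [t' ot E'] := @op_rel_ext o (count st) s s' Es os.
  by exists t'; split=> // r; rewrite E E'.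
have all_same : holds (env st st' a p0) (keep_all M K.+1 Active) ->
    count st' =1 count st.
  move=> /holds_keep_all k; apply: count_same => i x.
  by have [->|/keep_p //] := eqVneq i a; apply: k.
have flip c i x : c <= M ->
    holds (env st st' a p0) (keep_but M K.+1 Active c) ->
    (i, x) != (a, inord c) -> lvar (st' i) x = lvar (st i) x.
  move=> le_c /(holds_keep_but _ _ le_c) k; rewrite xpair_eqE negb_and.
  by have [->|/keep_p //] := eqVneq i a; apply: k.
have := op_p _ p0a; case: o ok_o op_p => [|c|c|c] /= ok_o op_p.
- by move=> /all_same E; exists (count st).
- move=> /and3P[/negbTE F T k]; eexists; first exact: erefl.
  by apply: (@count_flip _ _ a) => // i x; apply: flip k.
- move=> /and3P[T /negbTE F k].
  have E : count st =1 upd (count st') c (count st' c).+1.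
    by apply: (@count_flip _ _ a) => // i x /(flip _ _ _ ok_o k).
  exists (upd (count st) c (count st c).-1); last first.
    move=> r; rewrite /upd; case: eqP => [->|/eqP rc]; rewrite E.
      by rewrite upd_same.
    by rewrite /upd (negbTE rc).
  by rewrite /= [count st c]E upd_same.
- move=> /and3P[F _ k]; exists (count st); last exact: all_same.
  (* The guard was imposed with every passive thread in turn, so no thread at all has the variable
     true. *)
  split=> //; rewrite /count ok_o; apply/eqP; rewrite cards_eq0; apply/eqP.
  apply/setP => i; rewrite !inE; apply/negbTE.
  by have [->|/op_p /and3P[]] := eqVneq i a.
Qed.

Lemma dr_step_complete (st : state) q q' s s' : 1 < n -> at_loc st q ->
    count st =1 s -> mstep P (q, s) (q', s') ->
    (forall c, c <= M -> s' c <= n) ->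
  exists st' : state, [/\ @step (dr M K P) n st st', at_loc st' q' &
                          count st' =1 s'].
Proof.
move=> n2 Q Es [/=]; rewrite sizeP => lt_q; have := nth_ok lt_q.
case E: (nth _ _ _) => [[o t1] t2] /and3P[/= ok_o le1 le2] [os q'E] le_n.
have le_q' : q' < K.+1 by rewrite ltnS; case: q'E => ->.
(* Only the active thread [a] changes its variables, to [v], and all threads move to [q']. What
   remains is to choose [a] and [v] for each operation. *)
have lift_step (a : 'I_n) (v : pred 'I_M.+1) :
    let st' i := LState [ffun x => if i == a then v x else lvar (st i) x]
                        (inord q' : 'I_K.+1) in
    (forall p, p != a -> holds (env st st' a p) (op_formula M K.+1 o)) ->
    count st' =1 s' ->
    exists st' : state, [/\ @step (dr M K P) n st st', at_loc st' q' &
                            count st' =1 s'].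
  move=> st' H C; exists st'; split=> //; last by move=> i; rewrite /= inordK.
  apply/stepP; exists a => p pa; apply/andP; split.
    apply/andP; split; last by rewrite /= eqxx.
    by apply/holds_keep_all => x; rewrite /= ffunE (negbTE pa).
  apply/holds_body; exists q; first by rewrite sizeP.
  rewrite E /= H //; apply/and3P; split=> //.
    by apply/eqP/val_inj; rewrite /= inordK ?Q.
  by case: q'E => <-; rewrite eqxx ?orbT.
have a0 : 'I_n := Ordinal n2.
have idle : s' = s -> (forall p, p != a0 -> forall st' : state,
      (forall x, lvar (st' a0) x = lvar (st a0) x) ->
      holds (env st st' a0 p) (op_formula M K.+1 o)) ->
    exists st' : state, [/\ @step (dr M K P) n st st', at_loc st' q' &
                            count st' =1 s'].
  move=> ss H; apply: (@lift_step a0 (lvar (st a0))) => [p pa|].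
    by apply: H => // x; rewrite /= ffunE eqxx.
  rewrite ss => r; rewrite -Es; apply: count_same => i x; rewrite ffunE.
  by case: eqP => // ->.
case: o os ok_o lift_step idle {E} => [|c|c|c] /=.
- move=> -> _ _; apply=> // p pa st' k.
  by apply/holds_keep_all => x; apply: k.
- move=> s'E le_c lift_step _.
  (* If all threads had the variable true, the counter would already be [n] and its successor would
     violate [le_n]. *)
  have [a /negbTE Fa] : exists a, ~~ lvar (st a) (inord c).
    apply/existsP; rewrite -negb_forall; apply/negP => /forallP T.
    have := le_n c le_c; rewrite s'E upd_same -Es /count le_c.
    rewrite (_ : [set i | _] = setT) ?cardsT ?card_ord ?ltnn //.
    by apply/setP => i; rewrite !inE T.
  apply: (@lift_step a (fun x => (x == inord c) || lvar (st a) x)).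
    move=> p pa; rewrite Fa ffunE !eqxx /=.
    by apply/holds_keep_but => // x /negbTE xc; rewrite /= ffunE eqxx xc.
  move=> r; rewrite (@count_flip st _ a c) //; last first.
  + move=> i x; rewrite xpair_eqE negb_and /= ffunE.
    by case: eqP => //= -> /negbTE->.
  + by rewrite /= ffunE !eqxx.
  + by rewrite s'E /upd Es; case: eqP.
- move=> [s0 s'E] le_c lift_step _.
  have [a Ta] : exists a, lvar (st a) (inord c).
    move: s0; rewrite -Es /count le_c card_gt0 => /set0Pn[a].
    by rewrite inE; exists a.
  apply: (@lift_step a (fun x => (x != inord c) && lvar (st a) x)).
    move=> p pa; rewrite Ta ffunE !eqxx /=.
    by apply/holds_keep_but => // x xc; rewrite /= ffunE eqxx xc.
  set st' := fun i => _.
  have C : count st =1 upd (count st') c (count st' c).+1.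
    apply: (@count_flip st' _ a c) => //; first by rewrite /= ffunE !eqxx.
    move=> i x; rewrite xpair_eqE negb_and /= ffunE.
    by case: eqP => //= -> ->.
  move=> r; rewrite s'E /upd -!Es; case: eqP => [->|/eqP rc]; rewrite C.
    by rewrite upd_same.
  by rewrite /upd (negbTE rc).
- move=> [s0 ->] le_c _; apply=> // p pa st' k.
  have F i : ~~ lvar (st i) (inord c).
    move: s0; rewrite -Es /count le_c => /eqP.
    rewrite cards_eq0 => /eqP/setP/(_ i).
    by rewrite !inE => ->.
  by rewrite !F; apply/holds_keep_all => x; apply: k.
Qed.

Lemma dr_path_sound (st : state) sts q s : 1 < n -> at_loc st q ->
    count st =1 s -> path (@step (dr M K P) n) st sts ->
  exists k q' s', msteps P k (q, s) (q', s') /\ at_loc (last st sts) q'.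
Proof.
move=> n2; elim: sts st q s => [|st1 sts IH] st q s Q E /=.
  by exists 0, q, s.
move=> /andP[/(dr_step_sound n2 Q E)[q1 [s1 [m1 Q1 E1]]]].
move=> /(IH _ _ _ Q1 E1)[k [q' [s' [r Q']]]].
by exists k.+1, q', s'; split=> //; exists (q1, s1).
Qed.
End Simulation.

Lemma dr_path_complete M K P k q s q' s' :
    size P = K.+1 -> all (instr_ok M K) P ->
    msteps P k (q, s) (q', s') -> exists N, forall n, N <= n -> 1 < n ->
  forall st : 'I_n -> lstate M.+1 K.+1, at_loc st q -> count st =1 s ->
  exists sts, path (@step (dr M K P) n) st sts /\ at_loc (last st sts) q'.
Proof.
move=> sizeP okP; elim: k q s => [|k IH] q s /=.
  by move=> [<- _]; exists 0 => n _ _ st Q _; exists [::].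
(* A finite run meets finitely many counter values; as many threads as the largest of them
   suffice. *)
move=> [[q1 s1] m1 /IH[N H]]; exists (maxn N (\max_(c < M.+1) s1 c)).
move=> n; rewrite geq_max => /andP[le_N /bigmax_leqP le_n] n2 st Q E.
have [|st1 [step1 Q1 E1]] := dr_step_complete sizeP okP n2 Q E m1.
  by move=> c le_c; have := le_n (inord c) isT; rewrite inordK.
have [sts [run Q']] := H n le_N n2 st1 Q1 E1.
by exists (st1 :: sts); rewrite /= step1.
Qed.

Lemma holds_start M K (E : role -> lstate M.+1 K.+1) :
  reflect (forall r, pc (E r) = K :> nat /\ forall x, lvar (E r) x = false)
          (holds E (start M K)).
Proof.
apply: (iffP and3P) => [[/eqP /= a /eqP /= p /holds_zeros z] r|H].
  by split=> //; case: r; rewrite ?a ?p inordK.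
split; try by apply/eqP/val_inj; rewrite /= inordK ?(H _).1.
by apply/holds_zeros => r x; rewrite (H r).2.
Qed.

Theorem dr_reachable M K P : size P = K.+1 -> all (instr_ok M K) P ->
  @loc_reachable (dr M K P) (@ord0 K) <->
  exists k s', msteps P k (K, fun=> 0) (0, s').
Proof.
move=> sizeP okP; split.
  move=> [n [n2 [st [sts [/andP[/initP[a init_a] run] [i pc_i]]]]]].
  (* Every thread is either the initial active one or passive to it, so [start] constrains them
     all. *)
  have Z j : pc (st j) = K :> nat /\ forall x, lvar (st j) x = false.
    have [p pa] := exists_passive a n2.
    have [->|ja] := eqVneq j a.
      by have /holds_start/(_ Active) := init_a p pa.
    by have /holds_start/(_ Passive) := init_a j ja.
  have [||k [q [s' [r Q]]]] :=
    @dr_path_sound M K P n sizeP okP st sts K (fun=> 0) n2 _ _ run.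
  - by move=> j; case: (Z j).
  - move=> c; rewrite /count; case: ifP => // _; apply/eqP.
    by rewrite cards_eq0; apply/eqP/setP => j; rewrite !inE (Z j).2.
  by exists k, s'; move: r; rewrite -(Q i) pc_i.
move=> [k [s' /(dr_path_complete sizeP okP)[N H]]].
pose n := maxn N 2; have n2 : 1 < n by rewrite leq_max orbT.
pose st0 (i : 'I_n) : lstate M.+1 K.+1 := LState [ffun=> false] (inord K).
have [|||sts [run Q]] := H n _ n2 st0.
- exact: leq_maxl.
- by move=> i; rewrite /= inordK.
- move=> c; rewrite /count; case: ifP => // _; apply/eqP.
  by rewrite cards_eq0; apply/eqP/setP => j; rewrite !inE ffunE.
exists n; split=> //; exists st0, sts; split.
  apply/andP; split=> //; apply/initP; exists (Ordinal n2) => p _.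
  by apply/holds_start => -[]; split=> [|x]; rewrite /= ?inordK ?ffunE.
by exists (Ordinal n2); apply: val_inj; apply: Q.
Qed.

(** * Goedel numbers of the simulating programs *)

Local Notation gcode := CodeSeq.code.
Local Arguments CodeSeq.code : simpl never.

Definition same_code (r : role) (x : nat) : nat :=
  let v := gcode [:: 1; code_copy (r, Current); x] in
  let v' := gcode [:: 1; code_copy (r, Next); x] in
  gcode [:: 6; gcode [:: 5; v; v'];
               gcode [:: 5; gcode [:: 4; v]; gcode [:: 4; v']]].

Definition keep_code (r : role) (lo len : nat) : nat :=
  iteri len (fun k y => gcode [:: 5; y; same_code r (lo + k)])
    (gcode [:: 0; 1]).

(** Leading entries are constructor tags. In transition formulas the copies are numbered 0 and 1 for
    the active thread, current and next, and 2 and 3 for the passive one. *)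
Definition inc_code (M c : nat) : nat :=
  gcode [:: 5; gcode [:: 4; gcode [:: 1; 0; c]];
    gcode [:: 5; gcode [:: 1; 1; c];
      gcode [:: 5; keep_code Active 0 c; keep_code Active c.+1 (M - c)]]].

Definition op_code (M : nat) (o : op) : nat :=
  code_formula code_copy (op_formula M 1 o).

Definition instr_code (q ocode t1 t2 : nat) : nat :=
  gcode [:: 5; gcode [:: 2; 0; q];
    gcode [:: 5; ocode;
      gcode [:: 6; gcode [:: 2; 1; t1]; gcode [:: 2; 1; t2]]]].

(** Unlike [body] it does not mention [K], so lengthening a machine leaves the code of its prefix
    intact. *)
Fixpoint body_code (M : nat) (P : seq instr) (q : nat) : nat :=
  if q is q'.+1 then
    let: (o, t1, t2) := nth halt P q' in
    gcode [:: 6; body_code M P q'; instr_code q' (op_code M o) t1 t2]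
  else gcode [:: 0; 0].

Definition frame_code (M : nat) : nat :=
  gcode [:: 5; keep_code Passive 0 M.+1; gcode [:: 3; 3; 1]].

Definition zeros_code (len : nat) : nat :=
  iteri len (fun k y => gcode [:: 5; y;
      gcode [:: 5; gcode [:: 4; gcode [:: 1; 0; k]];
                   gcode [:: 4; gcode [:: 1; 1; k]]]])
    (gcode [:: 0; 1]).

Definition start_code (M K : nat) : nat :=
  gcode [:: 5; gcode [:: 2; 0; K];
    gcode [:: 5; gcode [:: 2; 1; K]; zeros_code M.+1]].

Lemma code_keep M k r lo len : lo + len <= M.+1 ->
  code_formula code_copy (keep M k r lo len) = keep_code r lo len.
Proof.
elim: len => [|l IH] // le_M; rewrite addnS in le_M.
by rewrite /= IH 1?ltnW // /same_code inordK.
Qed.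

Lemma code_op M k o : op_ok M o ->
  code_formula code_copy (op_formula M k o) = op_code M o.
Proof.
rewrite /op_code; case: o => [|c|c|c] ok /=; rewrite ?code_keep //.
all: by move: ok => /=; lia.
Qed.

Lemma op_code_inc M c : c <= M -> op_code M (Inc c) = inc_code M c.
Proof.
by move=> le_c; rewrite /op_code /= inordK // !code_keep //; lia.
Qed.

Lemma code_body M K P q : q <= K.+1 -> q <= size P -> all (instr_ok M K) P ->
  code_formula code_copy (body M K P q) = body_code M P q.
Proof.
move=> le_K le_P okP; elim: q le_K le_P => [|q IH] // lt_K lt_P.
have ok := all_nthP halt okP q lt_P.
rewrite /= IH; try exact: ltnW.
case: (nth _ _ _) ok => [[o t1] t2] /and3P[/= ok_o le1 le2].
by rewrite code_op // /instr_code !inordK.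
Qed.

Lemma code_frame M K : code_formula code_copy (frame M K) = frame_code M.
Proof. by rewrite /frame_code -(@code_keep M K.+1). Qed.

Lemma code_zeros M K len : len <= M.+1 ->
  code_formula code_role (zeros M K len) = zeros_code len.
Proof.
by elim: len => [|l IH] // lt_M; rewrite /= IH 1?ltnW // inordK.
Qed.

Lemma code_start M K : code_formula code_role (start M K) = start_code M K.
Proof.
rewrite /start_code -(@code_zeros M K) //.
by rewrite /start; cbn [code_formula]; rewrite inordK.
Qed.

Lemma body_codeS M P q : body_code M P q.+1 =
  let: (o, t1, t2) := nth halt P q in
  gcode [:: 6; body_code M P q; instr_code q (op_code M o) t1 t2].
Proof. by []. Qed.

Lemma body_code_rcons M P i q : q <= size P ->
  body_code M (rcons P i) q = body_code M P q.
Proof.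
elim: q => [|q IH] // lt_P; cbn [body_code].
by rewrite IH 1?ltnW // nth_rcons lt_P.
Qed.

Definition repeat (o : op) (n : nat) (e : prog) : prog :=
  iter n (Seq (Act o)) e.

Lemma plen_repeat o n e : plen (repeat o n e) = plen e + n.
Proof. by elim: n => [|n IH]; rewrite ?addn0 //= IH addn1 addnS. Qed.

(** Blocks are laid out downwards, so an instruction put in front of a program becomes the last one
    of its machine and jumps to the former entry [plen e + n]. *)
Lemma machine_repeatS o n e : machine (repeat o n.+1 e) =
  rcons (machine (repeat o n e)) (o, plen e + n, plen e + n).
Proof. by rewrite -(plen_repeat o) -cats1. Qed.

Lemma size_machine e : size (machine e) = (plen e).+1.
Proof. by rewrite /= size_code. Qed.

Lemma prog_ok_repeat M o n e :
  op_ok M o -> prog_ok M e -> prog_ok M (repeat o n e).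
Proof. by move=> ok_o ok_e; elim: n => //= n ->; rewrite ok_o. Qed.

Lemma den_repeat o (phi : (nat -> nat) -> nat -> nat) n e s s' :
    (forall s1 s2, op_rel o s1 s2 <-> s2 = phi s1) ->
  den (repeat o n e) s s' <-> den e (iter n phi s) s'.
Proof.
move=> op_phi; elim: n s => [|n IH] s //; rewrite iterSr -IH.
by split=> [[s1 /op_phi ->]|D] //; exists (phi s) => //; apply/op_phi.
Qed.

Lemma iter_inc c n s r :
  iter n (fun s1 => upd s1 c (s1 c).+1) s r = if r == c then s c + n else s r.
Proof.
elim: n => [|n IH] /=; first by rewrite addn0; case: eqP => [->|].
case: eqP IH => [->|rc] IH; first by rewrite upd_same IH addnS.
by rewrite upd_other.
Qed.

Definition tower (p ocode n base : nat) : nat :=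
  iteri n (fun i y =>
      gcode [:: 6; y; instr_code (p + i).+1 ocode (p + i) (p + i)])
    base.

Lemma body_code_repeat M o n e :
  body_code M (machine (repeat o n e)) (plen e + n).+1 =
  tower (plen e) (op_code M o) n (body_code M (machine e) (plen e).+1).
Proof.
elim: n => [|n IH]; first by rewrite addn0.
rewrite machine_repeatS addnS [LHS]body_codeS.
rewrite body_code_rcons; last by rewrite size_machine plen_repeat.
by rewrite nth_rcons size_machine plen_repeat ltnn eqxx IH.
Qed.

(* [L] and [B] are the length of a program and the code of its body formula;
   [loaded_code L B] is the code of the instance which first loads [L] and [B]
   into the counters 0 and 1 and then runs that program. *)
Definition loaded_code (L B : nat) : nat :=
  gcode [:: L.+2; (L + L + B).+1;
    gcode [:: 5; frame_code L.+1;
      tower (L + L) (inc_code L.+1 1) B (tower L (inc_code L.+1 0) L B)];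
    start_code L.+1 (L + L + B); 0].

Definition instance (M K : nat) (P : seq instr) : drinstance :=
  existT (fun P : drprog => 'I_(nlocs P)) (dr M K P) (@ord0 K).

Definition load (L B : nat) (e : prog) : prog :=
  repeat (Inc 1) B (repeat (Inc 0) L e).

Lemma code_instanceE M K P : size P = K.+1 -> all (instr_ok M K) P ->
  code_instance (instance M K P) =
  gcode [:: M.+1; K.+1; gcode [:: 5; frame_code M; body_code M P K.+1];
            start_code M K; 0].
Proof.
move=> sizeP okP; rewrite -(code_frame M K) -(code_start M K).
suff -> : body_code M P K.+1 =
  code_formula code_copy (body M K P (size P)) by [].
by rewrite code_body ?sizeP.
Qed.

Lemma load_ok (e : prog) L B : plen e = L -> prog_ok L.+1 e ->
  let P := machine (load L B e) in
  size P = (L + L + B).+1 /\ all (instr_ok L.+1 (L + L + B)) P.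
Proof.
move=> len_e ok_e P; have len_load : plen (load L B e) = L + L + B.
  by rewrite !plen_repeat len_e.
split; first by rewrite size_machine len_load.
rewrite /P /= -len_load; apply: (@code_ok _ _ 0).
by do 2!apply: prog_ok_repeat => //.
Qed.

(** The code of the loaded instance depends on [e] only through its length and its body code, two
    numbers that the program itself can receive in counters. *)
Lemma code_loaded e L B : plen e = L -> prog_ok L.+1 e ->
  body_code L.+1 (machine e) L.+1 = B ->
  code_instance (instance L.+1 (L + L + B) (machine (load L B e))) =
  loaded_code L B.
Proof.
move=> len_e ok_e codeB; have [sizeP okP] := load_ok B len_e ok_e.
rewrite code_instanceE // /loaded_code -!op_code_inc //.
have := body_code_repeat L.+1 (Inc 1) B (repeat (Inc 0) L e).
by rewrite plen_repeat (body_code_repeat _ (Inc 0)) len_e codeB => ->.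
Qed.

(** * Recursive functions *)

(** Placed in [Type] so that the functions for a family of components can be extracted and passed to
    [RComp]. *)
Definition recursive n (F : n.-tuple nat -> nat) : Type :=
  {f : recfun n | forall v, computes f v (F v)}.

Lemma eq_recursive n (F G : n.-tuple nat -> nat) :
  F =1 G -> recursive F -> recursive G.
Proof. by move=> E [f cf]; exists f => v; rewrite -E. Qed.

Lemma rec_proj n (i : 'I_n) : recursive (fun v : n.-tuple nat => tnth v i).
Proof. by exists (RProj i). Qed.

Lemma rec_comp m n (G : m.-tuple nat -> nat) (F : 'I_m -> n.-tuple nat -> nat) :
  recursive G -> (forall i, recursive (F i)) ->
  recursive (fun v => G [tuple F i v | i < m]).
Proof.
move=> [g cg] F_rec; exists (RComp g (fun i => sval (F_rec i))) => v.
exists [tuple F i v | i < m] => // i; rewrite tnth_mktuple.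
exact: (svalP (F_rec i)).
Qed.

Lemma rec_succ n (F : n.-tuple nat -> nat) :
  recursive F -> recursive (fun v => (F v).+1).
Proof.
move=> F_rec; have S_rec : recursive (fun v : 1.-tuple nat => (thead v).+1).
  by exists RSucc.
apply: eq_recursive (rec_comp S_rec (fun=> F_rec)) => v.
by rewrite /thead tnth_mktuple.
Qed.

Lemma rec_const n (c : nat) : recursive (fun _ : n.-tuple nat => c).
Proof. by elim: c => [|c IH]; [exists (RZero n) | apply: rec_succ]. Qed.

Lemma rec_behead n (F : n.-tuple nat -> nat) :
  recursive F -> recursive (fun v : n.+1.-tuple nat => F [tuple of behead v]).
Proof.
move=> F_rec.
apply: eq_recursive (rec_comp F_rec (fun i => rec_proj (lift ord0 i))) => v.
congr F; apply: eq_from_tnth => i; rewrite tnth_mktuple.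
by rewrite tnth_behead; congr tnth; apply: val_inj; rewrite /= inordK ?ltnS.
Qed.

Lemma rec_iteri n (F X : n.-tuple nat -> nat)
    (G : nat -> nat -> n.-tuple nat -> nat) :
    recursive F -> recursive X ->
    recursive (fun w : n.+2.-tuple nat =>
      G (tnth w ord0) (tnth w (lift ord0 ord0))
        [tuple of behead [tuple of behead w]]) ->
  recursive (fun v => iteri (X v) (fun i y => G i y v) (F v)).
Proof.
move=> [f cf] [x cx] [g cg].
exists (RComp (RPrim f g)
  (fun i => if unlift ord0 i is Some j then RProj j else x)) => v.
exists [tuple of X v :: v] => [i|].
  by case: unliftP => [j ->|->] /=; [rewrite tnthS | rewrite tnth0].
set w := [tuple of X v :: v].
have Ew : [tuple of behead w] = v by apply: val_inj.
rewrite [computes _ _]/= Ew (theadE (X v)).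
elim: (X v) => [|k IH] /=; first exact: cf.
set y := iteri k _ _ in IH *; exists y => //.
have := cg [tuple of k :: y :: v]; rewrite tnth0 tnthS tnth0.
have -> : [tuple of behead [tuple of behead [tuple of k :: y :: v]]] = v.
  exact: val_inj.
suff -> : [tuple of k :: y :: behead w] = [tuple of k :: y :: v] by [].
exact: val_inj.
Qed.

Lemma rec_add n (F G : n.-tuple nat -> nat) :
  recursive F -> recursive G -> recursive (fun v => F v + G v).
Proof.
move=> F_rec G_rec.
apply: (@eq_recursive _ (fun v => iteri (G v) (fun _ y => y.+1) (F v))).
  by move=> v; elim: (G v) => [|k IH]; rewrite ?addn0 //= IH addnS.
by apply: rec_iteri => //; apply: rec_succ; apply: rec_proj.
Qed.

(** As [code (n :: s)] is [2 ^ n * (2 * code s + 1)], it arises from [2 * code s + 1] by doubling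
    [n] times. *)
Lemma rec_code_cons n (F : n.-tuple nat -> nat) (l : n.-tuple nat -> seq nat) :
    recursive F -> recursive (fun v => gcode (l v)) ->
  recursive (fun v => gcode (F v :: l v)).
Proof.
move=> F_rec l_rec.
pose base v := (gcode (l v) + gcode (l v)).+1.
apply: (@eq_recursive _ (fun v => iteri (F v) (fun _ y => y + y) (base v))).
  move=> v; rewrite /gcode /= -/(gcode _) -addnn -/(base v).
  elim: (F v) => [|k IH] /=; first by rewrite mul1n.
  by rewrite IH expnS -mulnA mul2n addnn.
apply: rec_iteri => //; first by apply: rec_succ; apply: rec_add.
by apply: rec_add; apply: rec_proj.
Qed.

Lemma rec_behead2 n (F : n.-tuple nat -> nat) : recursive F ->
  recursive (fun v : n.+2.-tuple nat =>
    F [tuple of behead [tuple of behead v]]).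
Proof. by move=> /rec_behead/rec_behead. Qed.

Ltac rec_code :=
  repeat lazymatch goal with
  | |- recursive (fun _ => ?c) => apply: rec_const
  | |- recursive (fun _ => CodeSeq.code (_ :: _)) => apply: rec_code_cons
  | |- recursive (fun _ => _ + _) => apply: rec_add
  | |- recursive (fun _ => _.+1) => apply: rec_succ
  | |- recursive (fun _ => tnth _ _) => apply: rec_proj
  | |- _ => assumption
  end.

Lemma rec_keep_code n r (lo : nat) (len : n.-tuple nat -> nat) :
  recursive len -> recursive (fun v => keep_code r lo (len v)).
Proof.
move=> len_rec; apply: rec_iteri => //; first exact: rec_const.
by rewrite /same_code; rec_code.
Qed.

Lemma rec_zeros_code n (len : n.-tuple nat -> nat) :
  recursive len -> recursive (fun v => zeros_code (len v)).
Proof.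
by move=> len_rec; apply: rec_iteri => //; [apply: rec_const | rec_code].
Qed.

Lemma rec_tower n (p o k base : n.-tuple nat -> nat) :
    recursive p -> recursive o -> recursive k -> recursive base ->
  recursive (fun v => tower (p v) (o v) (k v) (base v)).
Proof.
move=> p_rec o_rec k_rec base_rec.
apply: (@rec_iteri _ base k (fun i y v =>
  gcode [:: 6; y; instr_code (p v + i).+1 (o v) (p v + i) (p v + i)])) => //.
have {}p_rec := rec_behead2 p_rec; have {}o_rec := rec_behead2 o_rec.
by rewrite /instr_code; rec_code.
Qed.

Ltac rec_formula_code :=
  repeat lazymatch goal with
  | |- recursive (fun _ => keep_code _ _ _) => apply: rec_keep_code
  | |- recursive (fun _ => zeros_code _) => apply: rec_zeros_code
  | |- recursive (fun _ => tower _ _ _ _) => apply: rec_tower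
  | |- _ => progress rec_code
  end.

Lemma rec_loaded_code n (L B : n.-tuple nat -> nat) :
  recursive L -> recursive B -> recursive (fun v => loaded_code (L v) (B v)).
Proof.
move=> L_rec B_rec; rewrite /loaded_code /frame_code /start_code /inc_code.
(* The lengths [M - c] in [inc_code] occur only for [M = L + 1] and [c] equal to 1 or 0, where they
   are [L] and [L + 1]. *)
have sub1_rec : recursive (fun v => (L v).+1 - 1).
  by apply: eq_recursive L_rec => v; rewrite subn1.
have sub0_rec : recursive (fun v => (L v).+1 - 0) by apply: rec_succ.
by rec_formula_code.
Qed.

(** * Diagonalization *)

(* The idle prefix makes the program at least as long as its counter indices,
   so that its length alone determines the number of variables to provide. *)
Definition runner (h : recfun 2) : prog :=
  let e := compile h [tuple 0; 1] 2 in repeat Nop (maxreg e) e.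

Lemma runner_ok h : prog_ok (plen (runner h)).+1 (runner h).
Proof.
by apply: prog_ok_repeat => //; apply: prog_okP; rewrite plen_repeat; lia.
Qed.

(** Loading puts [L] and [B] into counters 0 and 1, where the compiled [h] reads its arguments, and
    the [Nop] prefix preserves the state; so halting is definedness of [h]. *)
Lemma runner_reachable h B (L := plen (runner h)) :
  loc_reachable
    (projT2 (instance L.+1 (L + L + B) (machine (load L B (runner h))))) <->
  exists y, computes h [tuple L; B] y.
Proof.
have [sizeP okP] := load_ok B (erefl L) (runner_ok h).
rewrite (dr_reachable sizeP okP).
have -> : L + L + B = plen (load L B (runner h)) by rewrite /load 2!plen_repeat.
rewrite machineP.
pose inc c s := upd s c (s c).+1.
pose s0 := iter L (inc 0) (iter B (inc 1) (fun=> 0)).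
have -> : (exists s', den (load L B (runner h)) (fun=> 0) s') <->
    exists s', den (compile h [tuple 0; 1] 2) s0 s'.
  have den_load s' : den (load L B (runner h)) (fun=> 0) s' <->
      den (compile h [tuple 0; 1] 2) s0 s'.
    rewrite (@den_repeat _ (inc 1)) // (@den_repeat _ (inc 0)) //.
    by rewrite (@den_repeat _ id) // iter_fix.
  by split=> -[s' /den_load D]; exists s'.
have [sound complete] := @compileP _ h [tuple 0; 1] 2 isT s0.
have args : map_tuple s0 [tuple 0; 1] = [tuple L; B].
  by apply: val_inj; rewrite /= /s0 /inc !iter_inc.
rewrite args in sound complete.
by split=> [[s' /sound[_ c]]|[y /complete]] //; exists (s' 2).
Qed.

Theorem theorem5 :
  ~ recursively_decidable code_instance
      (fun x : drinstance => loc_reachable (projT2 x)).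
Proof.
move=> [f f_dec].
(* Argument 0 will be the search variable. The value does not depend on it, so the search succeeds
   at 0 or nowhere. *)
have [g g_code] : recursive (fun v : 3.-tuple nat =>
    loaded_code (tnth v (inord 1)) (tnth v (inord 2))).
  by apply: rec_loaded_code; apply: rec_proj.
pose h : recfun 2 := RMu (RComp f (fun _ : 'I_1 => g)).
(* Self-reference: [L] and [B] describe the runner of [h] itself, so [h] at this pair consults [f]
   about the very instance [x] that runs it. *)
pose L := plen (runner h).
pose B := body_code L.+1 (machine (runner h)) L.+1.
have code_x := code_loaded (erefl L) (runner_ok h) (erefl B).
set x := instance _ _ _ in code_x.
have reach_x : loc_reachable (projT2 x) <-> exists y, computes h [tuple L; B] y.
  exact: runner_reachable.
have g_at y : computes g [tuple of y :: [tuple L; B]] (code_instance x).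
  have := g_code [tuple of y :: [tuple L; B]].
  by rewrite code_x !(tnth_nth 0) /= !inordK.
have call_f y z : computes f [tuple code_instance x] z ->
    computes (RComp f (fun _ : 'I_1 => g)) [tuple of y :: [tuple L; B]] z.
  by move=> fz; exists [tuple code_instance x] => // i; rewrite (ord1 i).
have [f1 f0] := f_dec x.
have not_reach : ~ loc_reachable (projT2 x).
  (* Reachability makes the search for the answer 0 halt, yet [f] answers 1 on [x]. *)
  move=> reach; have [y /proj1 f_0] := proj1 reach_x reach.
  have f_1 := call_f y 1 (f1 reach).
  by have := @computes_fun _ (RComp f (fun=> g)) _ _ _ f_0 f_1.
(* Now [f] answers 0 on [x], so the search stops at its first candidate, and its halting makes the
   location reachable after all. *)
apply: (not_reach); apply/reach_x; exists 0; split=> //.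
exact: call_f (f0 not_reach).
Qed.
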